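(* Let $f_1$ be the probability mass function of the negative binomial distribution $\mathrm{NB}(\nu,\lambda)$ with $\nu>0$, $0<\lambda<1$, and let $f_2$ be the probability mass function of the Conway-Maxwell-Poisson distribution $\text{COM-Poisson}(\mu,\theta)$, where either $\mu>0$, $\theta>0$, or $0<\mu<1$, $\theta=0$. Let $\beta\in\mathbb{R}$, and put $p=\lambda^{\beta}\mu^{1-\beta}$ and $\alpha=\theta(1-\beta)+\beta$. Assume that either $\alpha>\beta$, or $\alpha=\beta$ and $0<p<1$. Then the exponential combination of $f_1$ and $f_2$ with weight $\beta$ is the probability mass function of the $\mathrm{ECOMP}(\nu,p,\alpha,\beta)$ distribution, that is, for every $k\ge 0$, $$\frac{\{f_1(k)\}^{\beta}\{f_2(k)\}^{1-\beta}}{\sum_{i=0}^{\infty}\{f_1(i)\}^{\beta}\{f_2(i)\}^{1-\beta}}=\frac{\{(\nu)_k\}^{\beta}}{(k!)^{\alpha}}\,p^k\Bigg/\sum_{i=0}^{\infty}\frac{\{(\nu)_i\}^{\beta}}{(i!)^{\alpha}}\,p^i .$$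
   Context: $(\nu)_k=\nu(\nu+1)\cdots(\nu+k-1)$, with $(\nu)_0=1$, is the Pochhammer symbol. $\mathrm{NB}(\nu,\lambda)$ has probability mass function $f_1(k)=\frac{(\nu)_k}{k!}\lambda^k(1-\lambda)^{\nu}$, $k=0,1,2,\dots$. $\text{COM-Poisson}(\mu,\theta)$ has probability mass function $f_2(k)=\frac{\mu^k}{(k!)^{\theta}}\big/\sum_{i=0}^{\infty}\frac{\mu^i}{(i!)^{\theta}}$, $k=0,1,2,\dots$. The exponential combination of two probability mass functions $f_1,f_2$ with weight $\beta$ is $k\mapsto f_1(k)^{\beta}f_2(k)^{1-\beta}/\sum_i f_1(i)^{\beta}f_2(i)^{1-\beta}$. The extended Conway-Maxwell-Poisson distribution $\mathrm{ECOMP}(\nu,p,\alpha,\beta)$ is the distribution on $\{0,1,2,\dots\}$ with probability mass function $P(X=k)=\frac{\{(\nu)_k\}^{\beta}}{(k!)^{\alpha}}p^k\big/\sum_{i=0}^{\infty}\frac{\{(\nu)_i\}^{\beta}}{(i!)^{\alpha}}p^i$, with parameters satisfying $\nu>0$ and either $p>0$, $\alpha>\beta$, or $0<p<1$, $\alpha=\beta$. *)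

(* Defs.v *)
From Stdlib Require Import Reals Factorial.
From Coquelicot Require Import Coquelicot.
Local Open Scope R_scope.

(* Real exponents are written with [Rpower x y = exp (y * ln x)], which is the
   usual power only for x > 0; every base it is applied to below is positive
   for parameters in the stated ranges. [Series] has a meaningless value for a
   divergent series. *)

(* (nu)_k = nu (nu + 1) ... (nu + k - 1) *)
Fixpoint pochhammer (nu : R) (k : nat) : R :=
  match k with
  | O => 1
  | S j => pochhammer nu j * (nu + INR j)
  end.

Definition is_pmf (f : nat -> R) : Prop :=
  (forall k, 0 <= f k) /\ is_series f 1.

Definition normalize (w : nat -> R) (k : nat) : R := w k / Series w.

Definition nb_pmf (nu lambda : R) (k : nat) : R :=
  pochhammer nu k / INR (fact k) * lambda ^ k * Rpower (1 - lambda) nu.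

Definition com_poisson_weight (mu theta : R) (k : nat) : R :=
  mu ^ k / Rpower (INR (fact k)) theta.

Definition com_poisson_pmf (mu theta : R) : nat -> R :=
  normalize (com_poisson_weight mu theta).

Definition exp_comb_weight (beta : R) (f1 f2 : nat -> R) (k : nat) : R :=
  Rpower (f1 k) beta * Rpower (f2 k) (1 - beta).

Definition exp_comb (beta : R) (f1 f2 : nat -> R) : nat -> R :=
  normalize (exp_comb_weight beta f1 f2).

Definition ecomp_weight (nu p alpha beta : R) (k : nat) : R :=
  Rpower (pochhammer nu k) beta / Rpower (INR (fact k)) alpha * p ^ k.

Definition ecomp_pmf (nu p alpha beta : R) : nat -> R :=
  normalize (ecomp_weight nu p alpha beta).

(* Main.v *)
Require Import Defs.
From Stdlib Require Import Reals Factorial Lra.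
From Coquelicot Require Import Coquelicot.
Local Open Scope R_scope.

(** Taking logarithms shows that [f1 k ^ beta * f2 k ^ (1 - beta)] is the ECOMP
    weight times a constant independent of [k], so both normalize to the same
    function. The ratio of consecutive ECOMP weights is
    [((nu + k) / (k + 1)) ^ beta * (k + 1) ^ (beta - alpha) * p], which tends to
    [0] if [beta < alpha] and to [p] if [alpha = beta]; d'Alembert's test gives
    summability. COM-Poisson weights are the case [beta = 0]. *)

Lemma Rpower_pos (x y : R) : 0 < Rpower x y.
Proof. apply exp_pos. Qed.

Lemma ln_Rpower (x y : R) : ln (Rpower x y) = y * ln x.
Proof. apply ln_exp. Qed.

Lemma pochhammer_pos (nu : R) (k : nat) : 0 < nu -> 0 < pochhammer nu k.
Proof.
  intros hnu; induction k as [|k IH]; simpl; [lra|].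
  apply Rmult_lt_0_compat; [exact IH|].
  pose proof (pos_INR k); lra.
Qed.

Lemma ecomp_weight_pos (nu p alpha beta : R) (k : nat) :
  0 < p -> 0 < ecomp_weight nu p alpha beta k.
Proof.
  intros hp; unfold ecomp_weight.
  apply Rmult_lt_0_compat; [|now apply pow_lt].
  apply Rdiv_lt_0_compat; apply Rpower_pos.
Qed.

(** On the logarithmic scale a weight is linear in its exponents, so multiplicative identities
    between weights reduce to [ring]. *)
Lemma ln_ecomp_weight (nu p alpha beta : R) (k : nat) :
  0 < p ->
  ln (ecomp_weight nu p alpha beta k) =
  beta * ln (pochhammer nu k) - alpha * ln (INR (fact k)) + INR k * ln p.
Proof.
  intros hp; unfold ecomp_weight.
  rewrite ln_mult; [|apply Rdiv_lt_0_compat; apply Rpower_pos|now apply pow_lt].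
  rewrite ln_div by apply Rpower_pos.
  rewrite !ln_Rpower, ln_pow by exact hp; ring.
Qed.

(** Both sides are positive, so it suffices to compare logarithms. The power [- alpha] of [k + 1] is
    split as [(beta - alpha) - beta]: the part [- beta] pairs with [nu + k], and each resulting
    factor has its own limit. *)
Lemma ecomp_weight_ratio (nu p alpha beta : R) (k : nat) :
  0 < nu -> 0 < p ->
  ecomp_weight nu p alpha beta (S k) / ecomp_weight nu p alpha beta k =
  Rpower ((nu + INR k) / INR (S k)) beta * Rpower (INR (S k)) (beta - alpha) * p.
Proof.
  intros hnu hp.
  assert (hk : 0 < INR (S k)) by apply lt_0_INR, Nat.lt_0_succ.
  assert (hnk : 0 < nu + INR k) by (pose proof (pos_INR k); lra).
  assert (hquot : 0 < (nu + INR k) / INR (S k)) by now apply Rdiv_lt_0_compat.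
  assert (hw : forall j, 0 < ecomp_weight nu p alpha beta j)
    by (intros j; now apply ecomp_weight_pos).
  pose proof (Rpower_pos ((nu + INR k) / INR (S k)) beta) as h1.
  pose proof (Rpower_pos (INR (S k)) (beta - alpha)) as h2.
  apply ln_inv.
  - now apply Rdiv_lt_0_compat.
  - now repeat apply Rmult_lt_0_compat.
  - rewrite ln_div, !ln_ecomp_weight by auto.
    rewrite !ln_mult, !ln_Rpower, ln_div by (try apply Rmult_lt_0_compat; auto).
    rewrite fact_simpl, mult_INR, (ln_mult (INR (S k))) by (auto using INR_fact_lt_0).
    change (pochhammer nu (S k)) with (pochhammer nu k * (nu + INR k)).
    rewrite ln_mult by (auto using pochhammer_pos).
    rewrite S_INR; ring.
Qed.

Lemma is_lim_seq_INR_S : is_lim_seq (fun k => INR (S k)) p_infty.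
Proof. apply -> is_lim_seq_incr_1; apply is_lim_seq_INR. Qed.

(** The quotient equals [1 + (nu - 1) / (k + 1)], hence tends to 1, and the power function is
    continuous at 1. *)
Lemma is_lim_seq_Rpower_quotient (nu beta : R) :
  is_lim_seq (fun k => Rpower ((nu + INR k) / INR (S k)) beta) 1.
Proof.
  assert (hq : is_lim_seq (fun k => (nu + INR k) / INR (S k)) 1).
  { apply is_lim_seq_ext with (fun k => 1 + (nu - 1) * / INR (S k)).
    { intros k; pose proof (pos_INR k); rewrite S_INR; field; lra. }
    replace (Finite 1) with (Finite (1 + (nu - 1) * 0)) by (f_equal; ring).
    apply is_lim_seq_plus'; [apply is_lim_seq_const|].
    apply (is_lim_seq_scal_l _ (nu - 1) 0).
    apply (is_lim_seq_inv _ _ is_lim_seq_INR_S); discriminate. }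
  replace (Finite 1) with (Finite (Rpower 1 beta)) by 
    (unfold Rpower; now rewrite ln_1, Rmult_0_r, exp_0).
  apply (is_lim_seq_continuous (fun x => Rpower x beta)); [|exact hq].
  apply derivable_continuous_pt.
  exists (beta * Rpower 1 (beta - 1)); apply derivable_pt_lim_power; lra.
Qed.

Lemma is_lim_seq_Rpower_neg (d : R) :
  d < 0 -> is_lim_seq (fun k => Rpower (INR (S k)) d) 0.
Proof.
  intros hd.
  (* By definition the power is [exp (d * ln (k + 1))], so it is enough that the exponent tends to
     minus infinity. *)
  apply (filterlim_comp _ _ _ (fun k => d * ln (INR (S k))) exp _ (Rbar_locally m_infty));
    [|exact is_lim_exp_m].
  change (is_lim_seq (fun k => d * ln (INR (S k))) m_infty).
  assert (hln : is_lim_seq (fun k => ln (INR (S k))) p_infty).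
  { apply (filterlim_comp _ _ _ (fun k => INR (S k)) ln _ (Rbar_locally p_infty));
      [exact is_lim_seq_INR_S | exact is_lim_ln_p]. }
  replace m_infty with (Rbar_mult d p_infty).
  - now apply is_lim_seq_scal_l.
  - rewrite Rbar_mult_comm; apply is_Rbar_mult_unique.
    now apply is_Rbar_mult_p_infty_neg.
Qed.

Lemma ex_series_ecomp_weight (nu p alpha beta : R) :
  0 < nu -> 0 < p -> beta < alpha \/ (alpha = beta /\ p < 1) ->
  ex_series (ecomp_weight nu p alpha beta).
Proof.
  intros hnu hp hab.
  assert (hw : forall k, 0 < ecomp_weight nu p alpha beta k)
    by (intros k; now apply ecomp_weight_pos).
  assert (hl : exists l, l < 1 /\
    is_lim_seq (fun k => Rpower ((nu + INR k) / INR (S k)) beta *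
                         Rpower (INR (S k)) (beta - alpha) * p) l).
  (* Only the factor with exponent [beta - alpha] distinguishes the two parameter ranges: its limit
     is 0 when the exponent is negative and 1 when it vanishes, where [p < 1] is what keeps the
     ratio limit below 1. *)
  { assert (hpow : exists l, l * p < 1 /\
      is_lim_seq (fun k => Rpower (INR (S k)) (beta - alpha)) l).
    { destruct hab as [h | [-> h]].
      - exists 0; split; [lra | apply is_lim_seq_Rpower_neg; lra].
      - exists 1; split; [lra |].
        apply is_lim_seq_ext with (fun _ => 1); [|apply is_lim_seq_const].
        intros k; rewrite Rminus_diag, Rpower_O; [reflexivity|].
        apply lt_0_INR, Nat.lt_0_succ. }
    destruct hpow as [l [hl1 hl]].
    exists (1 * l * p); split; [lra|].
    apply is_lim_seq_mult'; [|apply is_lim_seq_const].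
    apply is_lim_seq_mult'; [apply is_lim_seq_Rpower_quotient | exact hl]. }
  destruct hl as [l [hl1 hl]].
  apply ex_series_Rabs, (ex_series_DAlembert _ l hl1).
  - intros k; apply Rgt_not_eq, hw.
  - eapply is_lim_seq_ext; [|exact hl].
    intros k; cbv beta.
    rewrite Rabs_pos_eq by (apply Rlt_le, Rdiv_lt_0_compat; auto).
    symmetry; exact (ecomp_weight_ratio nu p alpha beta k hnu hp).
Qed.

(** The exponent 0 turns the Pochhammer factor into 1, whatever the positive [nu]. This brings the
    COM-Poisson normalizing series under the ECOMP convergence criterion. *)
Lemma com_poisson_weight_ecomp (nu mu theta : R) (k : nat) :
  0 < nu -> com_poisson_weight mu theta k = ecomp_weight nu mu theta 0 k.
Proof.
  intros hnu; unfold com_poisson_weight, ecomp_weight.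
  rewrite Rpower_O by now apply pochhammer_pos.
  unfold Rdiv; ring.
Qed.

(** The first term is positive and the remaining tail is nonnegative. *)
Lemma Series_pos (w : nat -> R) :
  (forall k, 0 < w k) -> ex_series w -> 0 < Series w.
Proof.
  intros hw hex.
  rewrite Series_incr_1 by exact hex.
  assert (0 <= Series (fun k => w (S k))).
  (* The bound 0 is rewritten as the sum of [0 * w (S k)], so that the series can be compared
     termwise. *)
  { rewrite <- (Rmult_0_l (Series (fun k => w (S k)))), <- Series_scal_l.
    apply Series_le; [|now apply -> (ex_series_incr_1 w)].
    intros k; rewrite Rmult_0_l; split; [apply Rle_refl|].
    now apply Rlt_le. }
  pose proof (hw O); lra.
Qed.

Lemma is_pmf_normalize (w : nat -> R) :
  (forall k, 0 < w k) -> ex_series w -> is_pmf (normalize w).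
Proof.
  intros hw hex.
  pose proof (Series_pos w hw hex) as hS.
  split.
  - intros k; apply Rlt_le, Rdiv_lt_0_compat; auto.
  - replace 1 with (scal (/ Series w) (Series w))
      by (unfold scal; simpl; unfold mult; simpl; field; lra).
    apply is_series_ext with (fun k => scal (/ Series w) (w k)).
    { intros k; apply Rmult_comm. }
    exact (is_series_scal (/ Series w) w _ (Series_correct w hex)).
Qed.

Lemma normalize_scal (c : R) (v w : nat -> R) (k : nat) :
  c <> 0 -> Series w <> 0 -> (forall j, v j = c * w j) ->
  normalize v k = normalize w k.
Proof.
  intros hc hw hv; unfold normalize.
  rewrite (Series_ext _ _ hv), Series_scal_l, hv; now field.
Qed.

(** The constant collects the normalizers [(1 - lambda) ^ nu] and [1 / Z], raised to [beta] and
    [1 - beta]. The factorial receives exponent [- beta] from the first law and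
    [- theta * (1 - beta)] from the second, and the geometric factors merge into the power of
    [p]. *)
Lemma exp_comb_weight_nb_com_poisson (nu lambda mu theta beta : R) (k : nat) :
  0 < nu -> 0 < lambda < 1 -> 0 < mu ->
  0 < Series (com_poisson_weight mu theta) ->
  exp_comb_weight beta (nb_pmf nu lambda) (com_poisson_pmf mu theta) k =
  Rpower (1 - lambda) (nu * beta) *
  Rpower (Series (com_poisson_weight mu theta)) (beta - 1) *
  ecomp_weight nu (Rpower lambda beta * Rpower mu (1 - beta))
    (theta * (1 - beta) + beta) beta k.
Proof.
  intros hnu [hl0 hl1] hmu hZ.
  set (Z := Series (com_poisson_weight mu theta)) in *.
  assert (hp : 0 < Rpower lambda beta * Rpower mu (1 - beta))
    by (apply Rmult_lt_0_compat; apply Rpower_pos).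
  pose proof (INR_fact_lt_0 k) as hfact.
  pose proof (pochhammer_pos nu k hnu) as hpoch.
  pose proof (pow_lt lambda k hl0) as hlk.
  pose proof (pow_lt mu k hmu) as hmk.
  pose proof (Rpower_pos (1 - lambda) nu) as hnorm.
  pose proof (Rpower_pos (INR (fact k)) theta) as hft.
  (* Positivity of each partial product is recorded for the side conditions of the logarithm rules
     below. *)
  assert (hwk : 0 < com_poisson_weight mu theta k) by now apply Rdiv_lt_0_compat.
  assert (hpf : 0 < pochhammer nu k / INR (fact k)) by now apply Rdiv_lt_0_compat.
  assert (hpfl : 0 < pochhammer nu k / INR (fact k) * lambda ^ k)
    by now apply Rmult_lt_0_compat.
  apply ln_inv.
  - apply Rmult_lt_0_compat; apply Rpower_pos.
  - apply Rmult_lt_0_compat; [apply Rmult_lt_0_compat; apply Rpower_pos|].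
    now apply ecomp_weight_pos.
  - unfold exp_comb_weight.
    rewrite ln_mult, !ln_Rpower by apply Rpower_pos.
    unfold nb_pmf, com_poisson_pmf, normalize; fold Z.
    rewrite (ln_div _ Z), (ln_mult _ (Rpower (1 - lambda) nu)), (ln_mult _ (lambda ^ k))
      by assumption.
    rewrite (ln_div (pochhammer nu k)), ln_Rpower by assumption.
    unfold com_poisson_weight; rewrite (ln_div (mu ^ k)), ln_Rpower by assumption.
    rewrite !ln_pow by assumption.
    rewrite ln_mult;
      [| apply Rmult_lt_0_compat; apply Rpower_pos | now apply ecomp_weight_pos].
    rewrite ln_ecomp_weight by exact hp.
    rewrite !ln_mult, !ln_Rpower by apply Rpower_pos.
    ring.
Qed.

Theorem mainTheorem2
  (nu lambda mu theta beta p alpha : R)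
  (hnu : 0 < nu)
  (hlambda : 0 < lambda < 1)
  (hmutheta : (0 < mu /\ 0 < theta) \/ (0 < mu < 1 /\ theta = 0))
  (hp : p = Rpower lambda beta * Rpower mu (1 - beta))
  (halpha : alpha = theta * (1 - beta) + beta)
  (hab : beta < alpha \/ (alpha = beta /\ 0 < p < 1)) :
  let f1 := nb_pmf nu lambda in
  let f2 := com_poisson_pmf mu theta in
  ex_series (exp_comb_weight beta f1 f2) /\
  ex_series (ecomp_weight nu p alpha beta) /\
  is_pmf (exp_comb beta f1 f2) /\
  forall k : nat, exp_comb beta f1 f2 k = ecomp_pmf nu p alpha beta k.
Proof.
  intros f1 f2.
  assert (hmu : 0 < mu) by (destruct hmutheta; lra).
  assert (hppos : 0 < p)
    by (rewrite hp; apply Rmult_lt_0_compat; apply Rpower_pos).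
  assert (hZ : 0 < Series (com_poisson_weight mu theta)).
  { rewrite (Series_ext _ _ (fun k => com_poisson_weight_ecomp nu mu theta k hnu)).
    apply Series_pos; [intros k; now apply ecomp_weight_pos|].
    apply ex_series_ecomp_weight; [assumption..|].
    (* With [theta] and 0 in the roles of [alpha] and [beta], the COM-Poisson parameter ranges are
       the two cases of the criterion. *)
    destruct hmutheta as [[_ h] | [h ->]]; [now left | right; lra]. }
  set (c := Rpower (1 - lambda) (nu * beta) *
            Rpower (Series (com_poisson_weight mu theta)) (beta - 1)).
  assert (hc : 0 < c) by (apply Rmult_lt_0_compat; apply Rpower_pos).
  assert (hw : forall k, exp_comb_weight beta f1 f2 k = c * ecomp_weight nu p alpha beta k)
    by (intros k; rewrite hp, halpha; now apply exp_comb_weight_nb_com_poisson).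
  assert (hex : ex_series (ecomp_weight nu p alpha beta)).
  { apply ex_series_ecomp_weight; [assumption..|]; lra. }
  assert (hexc : ex_series (exp_comb_weight beta f1 f2)).
  { apply ex_series_ext with (fun k => c * ecomp_weight nu p alpha beta k);
      [intros k; symmetry; apply hw | exact (ex_series_scal c (ecomp_weight nu p alpha beta) hex)]. }
  split; [exact hexc | split; [exact hex | split]].
  - apply is_pmf_normalize; [|exact hexc].
    intros k; apply Rmult_lt_0_compat; apply Rpower_pos.
  (* The common factor [c] cancels between each weight and the sum. *)
  - intros k; apply normalize_scal with c; [lra | | exact hw].
    apply Rgt_not_eq, Series_pos; [|exact hex].
    intros j; now apply ecomp_weight_pos.
Qed.
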